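(* Let $\Bbbk$ be a field, let $G$ be a finite simple graph on $\{x_1,\dots,x_n\}$, and let $S=\Bbbk[x_1,\dots,x_n]$. Then $$S_{2}\text{-}\mathrm{depth}(S/J(G)^{(\ell)})\geq S_{2}\text{-}\mathrm{depth}(S/J(G)^{(\ell+1)})\quad\text{for all }\ell\ge 1.$$
   Context: $\mathfrak m=(x_1,\dots,x_n)$ and $\omega_S$ is the canonical module of $S$. For an unmixed finitely generated graded $S$-module $M$ and $r\ge 2$, $S_r\text{-}\mathrm{depth}(M)=\min\{j : \dim K_M^j\ge j-r+1\}$, where $K_M^j=\mathrm{Hom}_{\Bbbk}(H^j_{\mathfrak m}(M),\Bbbk)\cong \mathrm{Ext}_S^{n-j}(M,\omega_S)$, $\dim$ is Krull dimension, and $\dim 0=-\infty$. The cover ideal of $G$ is $J(G)=(x_{i_1}\cdots x_{i_s} : \{x_{i_1},\dots,x_{i_s}\}\text{ is a vertex cover of }G)\subset S$, where a vertex cover is a set of vertices meeting every edge. For a squarefree monomial ideal $I$, the $\ell$-th symbolic power is $I^{(\ell)}=\bigcap_{P\in\mathrm{Ass}(I)}P^\ell$. *)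

(* Defs.v *)
From HB Require Import structures.
From mathcomp Require Import all_boot all_order all_algebra.
From mathcomp Require Import boolp mpoly ring.

Set Implicit Arguments.
Unset Strict Implicit.
Unset Printing Implicit Defensive.

Import Order.TTheory GRing.Theory Num.Theory.
Local Open Scope ring_scope.
Local Open Scope quotient_scope.

(** * Quotient modules *)

Section QuotientModule.
Variables (R : nzRingType) (V : lmodType R) (W : submodClosed V).

(* [W] with its structure of additive subgroup, as required by [Quotient.quot]. *)
Definition zmod_pred : {pred V} := W.

Fact zmod_pred_closed : zmod_closed zmod_pred.
Proof.
split=> [|u v uW vW]; first exact: (rpred0 W).
by rewrite -scaleN1r; apply: (rpredD uW); apply: rpredZ.
Qed.
HB.instance Definition _ := GRing.isZmodClosed.Build V zmod_pred zmod_pred_closed.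

Definition quotmod := Quotient.quot zmod_pred.
HB.instance Definition _ := GRing.Zmodule.on quotmod.

Definition to_quotmod (v : V) : quotmod := \pi_(Quotient.quot zmod_pred) v.

Lemma to_quotmodE u v : to_quotmod u = to_quotmod v <-> u - v \in W.
Proof.
rewrite -[u - v \in W]/(u - v \in zmod_pred) Quotient.idealrBE.
by split => [/eqP|/eqP].
Qed.

Lemma to_quotmod_repr (x : quotmod) : to_quotmod (repr (x : Quotient.quot zmod_pred)) = x.
Proof. exact: reprK. Qed.

Lemma to_quotmodD u v : to_quotmod (u + v) = to_quotmod u + to_quotmod v.
Proof. by rewrite /to_quotmod; apply: (raddfD (\pi_(Quotient.quot zmod_pred))). Qed.

Definition quotmod_scale (a : R) (x : quotmod) : quotmod :=
  to_quotmod (a *: repr (x : Quotient.quot zmod_pred)).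

Lemma quotmod_scaleE a v : quotmod_scale a (to_quotmod v) = to_quotmod (a *: v).
Proof.
apply/to_quotmodE; rewrite -scalerBr rpredZ //.
by apply/to_quotmodE; rewrite to_quotmod_repr.
Qed.

Lemma quotmod_scalerA a b x :
  quotmod_scale a (quotmod_scale b x) = quotmod_scale (a * b) x.
Proof. by rewrite -[x]to_quotmod_repr !quotmod_scaleE scalerA. Qed.

Lemma quotmod_scale1r : left_id 1 quotmod_scale.
Proof. by move=> x; rewrite -[x]to_quotmod_repr quotmod_scaleE scale1r. Qed.

Lemma quotmod_scalerDr : right_distributive quotmod_scale +%R.
Proof.
move=> a x y; rewrite -[x]to_quotmod_repr -[y]to_quotmod_repr.
by rewrite -to_quotmodD !quotmod_scaleE -to_quotmodD scalerDr.
Qed.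

Lemma quotmod_scalerDl x : {morph quotmod_scale^~ x : a b / a + b}.
Proof.
move=> a b; rewrite -[x]to_quotmod_repr !quotmod_scaleE.
by rewrite -to_quotmodD scalerDl.
Qed.

HB.instance Definition _ := GRing.Zmodule_isLmodule.Build R quotmod
  quotmod_scalerA quotmod_scale1r quotmod_scalerDr quotmod_scalerDl.

End QuotientModule.

(** * Ideals *)

(* An ideal of [R] is a [submodClosed] predicate on the regular module [R^o];
   it need not be proper. *)
Section Ideals.
Variable R : comNzRingType.
Implicit Types (X : R -> Prop) (I P : {pred R}).

Definition ideal_gen X : {pred R^o} := fun f =>
  `[< exists s : seq (R * R),
        (forall c, c \in s -> X c.2) /\ f = \sum_(c <- s) c.1 * c.2 >].

Lemma ideal_gen_submod X : submod_closed (ideal_gen X).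
Proof.
split; first by apply/asboolP; exists [::]; split => //; rewrite big_nil.
move=> a u v /asboolP[s [sX ->]] /asboolP[t [tX ->]]; apply/asboolP.
exists ([seq (a * c.1, c.2) | c <- s] ++ t); split.
  move=> c; rewrite mem_cat => /orP[/mapP[c' c's ->]|]; last exact: tX.
  exact: (sX c').
rewrite big_cat /= big_map; congr (_ + _).
rewrite /GRing.scale /= mulr_sumr; apply: eq_bigr => c _; exact: mulrA.
Qed.
HB.instance Definition _ X :=
  GRing.isSubmodClosed.Build R R^o (ideal_gen X)
    (GRing.submod_closed_semi (ideal_gen_submod X)).

Definition ideal_pow P (l : nat) : {pred R^o} :=
  ideal_gen (fun f => exists t : l.-tuple R, {subset t <= P} /\ f = \prod_(g <- t) g).
HB.instance Definition _ P l := GRing.SubmodClosed.on (ideal_pow P l).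

(* [P] is an associated prime of [R / I], that is, [P = I : f] for some [f]. *)
Definition is_ass I (P : prime_idealr R) : Prop :=
  exists f, forall a, (a \in P) = (a * f \in I).

(* The symbolic power of a squarefree monomial ideal (for other ideals the usual
   definition contracts localizations instead). *)
Definition symbolic_pow I (l : nat) : {pred R^o} := fun f =>
  `[< forall P : prime_idealr R, is_ass I P -> f \in ideal_pow P l >].

Lemma symbolic_pow_submod I l : submod_closed (symbolic_pow I l).
Proof.
split; first by apply/asboolP => P _; exact: rpred0.
move=> a u v /asboolP uI /asboolP vI; apply/asboolP => P IP.
by rewrite rpredD ?rpredZ ?uI ?vI.
Qed.
HB.instance Definition _ I l :=
  GRing.isSubmodClosed.Build R R^o (symbolic_pow I l)
    (GRing.submod_closed_semi (symbolic_pow_submod I l)).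

End Ideals.

(** * Krull dimension *)

Definition annihilates (R : comNzRingType) (M : lmodType R) (a : R) : Prop :=
  forall m : M, a *: m = 0.

(* [t <= dim M], where [dim M] is the supremum of the lengths [s] of the chains
   of primes [P_0 < ... < P_s] containing [Ann M].  It fails for every [t] when
   [M = 0], in accordance with [dim 0 = -oo]. *)
Definition krull_dim_ge (R : comNzRingType) (M : lmodType R) (t : int) : Prop :=
  exists (s : nat) (P : 'I_s.+1 -> prime_idealr R),
    [/\ t <= s%:Z,
        forall a, annihilates M a -> a \in P ord0
      & forall i j : 'I_s.+1, (i < j)%N ->
          {subset P i <= P j} /\ exists2 a, a \in P j & a \notin P i].

(** * Localization of a module at the powers of an element *)

Section Localization.
Variables (R : comNzRingType) (M : lmodType R) (f : R).

(* [(m, t)] stands for the fraction [m / f ^+ t]. *)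
Definition loc_eq : rel (M * nat) := fun x y =>
  `[< exists s : nat, f ^+ (s + y.2) *: x.1 = f ^+ (s + x.2) *: y.1 >].

Lemma loc_eq_equiv : equiv_class_of loc_eq.
Proof.
split=> [x|x y|y x z].
- by apply/asboolP; exists 0%N.
- by apply/asboolP/asboolP => -[s E]; exists s.
move=> /asboolP[s E1] /asboolP[s' E2]; apply/asboolP.
exists (s + s' + y.2)%N.
have -> : (s + s' + y.2 + z.2 = (s' + z.2) + (s + y.2))%N by ring.
rewrite exprD -scalerA E1 scalerA mulrC -scalerA E2 scalerA -exprD.
by congr (_ ^+ _ *: _); ring.
Qed.

Canonical loc_eq_canonical := EquivRelPack loc_eq_equiv.
Canonical loc_encModRel := defaultEncModRel loc_eq.

Definition loc := {eq_quot loc_eq}.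
HB.instance Definition _ := Choice.on loc.

Definition frac (m : M) (t : nat) : loc := \pi_({eq_quot loc_eq}) (m, t).
Definition numer (x : loc) : M := (repr (x : {eq_quot loc_eq})).1.
Definition denom (x : loc) : nat := (repr (x : {eq_quot loc_eq})).2.

Lemma fracK x : frac (numer x) (denom x) = x.
Proof. by rewrite /frac -surjective_pairing reprK. Qed.

Lemma fracE m t m' t' : frac m t = frac m' t' <->
  exists s : nat, f ^+ (s + t') *: m = f ^+ (s + t) *: m'.
Proof.
rewrite /frac; split.
  by move/eqmodP => /asboolP.
by move=> h; apply/eqmodP/asboolP.
Qed.

Lemma frac_repr m t : exists s : nat,
  f ^+ (s + denom (frac m t)) *: m = f ^+ (s + t) *: numer (frac m t).
Proof. by apply/fracE; rewrite fracK. Qed.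

Definition loc_zero : loc := frac 0 0.
Definition loc_opp (x : loc) : loc := frac (- numer x) (denom x).
Definition loc_add (x y : loc) : loc :=
  frac (f ^+ denom y *: numer x + f ^+ denom x *: numer y) (denom x + denom y).
Definition loc_scale (a : R) (x : loc) : loc := frac (a *: numer x) (denom x).

Lemma loc_oppE m t : loc_opp (frac m t) = frac (- m) t.
Proof.
have [s E] := frac_repr m t; apply/fracE; exists s.
by rewrite !scalerN E.
Qed.

Lemma loc_scaleE a m t : loc_scale a (frac m t) = frac (a *: m) t.
Proof.
have [s E] := frac_repr m t; apply/fracE; exists s.
by rewrite !scalerA ![_ * a]mulrC -!scalerA E.
Qed.

Lemma loc_addE m t m' t' :
  loc_add (frac m t) (frac m' t') =
  frac (f ^+ t' *: m + f ^+ t *: m') (t + t').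
Proof.
have [s E] := frac_repr m t; have [s' E'] := frac_repr m' t'.
rewrite /loc_add.
move: (numer (frac m t)) (denom (frac m t)) E => n u E.
move: (numer (frac m' t')) (denom (frac m' t')) E' => n' u' E'.
apply/fracE; exists (s + s')%N; rewrite !scalerDr !scalerA -!exprD.
congr (_ + _).
  have -> : (s + s' + (t + t') + u' = (s' + t' + u') + (s + t))%N by ring.
  rewrite exprD -scalerA -E scalerA -exprD.
  by congr (_ ^+ _ *: _); ring.
have -> : (s + s' + (t + t') + u = (s + t + u) + (s' + t'))%N by ring.
rewrite exprD -scalerA -E' scalerA -exprD.
by congr (_ ^+ _ *: _); ring.
Qed.

Lemma loc_addA : associative loc_add.
Proof.
move=> x y z; rewrite -[x]fracK -[y]fracK -[z]fracK !loc_addE !scalerDr !scalerA.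
by rewrite -!exprD !addrA addnA; congr (frac (_ ^+ _ *: _ + _ ^+ _ *: _ + _ ^+ _ *: _) _);
  ring.
Qed.

Lemma loc_addC : commutative loc_add.
Proof.
by move=> x y; rewrite -[x]fracK -[y]fracK !loc_addE addrC addnC.
Qed.

Lemma loc_add0 : left_id loc_zero loc_add.
Proof.
by move=> x; rewrite -[x]fracK loc_addE scaler0 add0r expr0 scale1r.
Qed.

Lemma loc_addN : left_inverse loc_zero loc_opp loc_add.
Proof.
move=> x; rewrite -[x]fracK loc_oppE loc_addE scalerN addNr.
by apply/fracE; exists 0%N; rewrite !scaler0.
Qed.

HB.instance Definition _ :=
  GRing.isZmodule.Build loc loc_addA loc_addC loc_add0 loc_addN.

Lemma fracD m t m' t' :
  frac m t + frac m' t' = frac (f ^+ t' *: m + f ^+ t *: m') (t + t').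
Proof. exact: loc_addE. Qed.

Lemma fracDl m m' t : frac (m + m') t = frac m t + frac m' t.
Proof.
rewrite fracD; apply/fracE; exists 0%N.
by rewrite -scalerDr scalerA -exprD.
Qed.

Lemma loc_scalerA a b x : loc_scale a (loc_scale b x) = loc_scale (a * b) x.
Proof. by rewrite -[x]fracK !loc_scaleE scalerA. Qed.

Lemma loc_scale1r : left_id 1 loc_scale.
Proof. by move=> x; rewrite -[x]fracK loc_scaleE scale1r. Qed.

Lemma loc_scalerDr : right_distributive loc_scale +%R.
Proof.
move=> a x y; rewrite -[x]fracK -[y]fracK fracD !loc_scaleE fracD scalerDr.
by rewrite !scalerA ![a * _]mulrC.
Qed.

Lemma loc_scalerDl x : {morph loc_scale^~ x : a b / a + b}.
Proof. by move=> a b; rewrite -[x]fracK !loc_scaleE scalerDl fracDl. Qed.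

HB.instance Definition _ := GRing.Zmodule_isLmodule.Build R loc
  loc_scalerA loc_scale1r loc_scalerDr loc_scalerDl.

Lemma fracZ a m t : a *: frac m t = frac (a *: m) t.
Proof. exact: loc_scaleE. Qed.

End Localization.

Section LocalizationMap.
Variables (R : comNzRingType) (M : lmodType R).

(* The canonical map [M_f -> M_g], [m / f ^+ t |-> h ^+ t m / g ^+ t], for
   [g = h * f] (junk otherwise). *)
Definition loc_map (f g h : R) (x : loc M f) : loc M g :=
  frac g (h ^+ denom x *: numer x) (denom x).

Lemma loc_map_frac f g h m t : g = h * f ->
  loc_map g h (frac f m t) = frac g (h ^+ t *: m) t.
Proof.
move=> gE; rewrite /loc_map; have [s E] := frac_repr f m t.
move: (numer _) (denom _) E => n u E.
apply/fracE; exists s; rewrite !scalerA gE !exprMn.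
have -> : h ^+ (s + t) * f ^+ (s + t) * h ^+ u =
  h ^+ (s + t + u) * f ^+ (s + t) by rewrite mulrAC -exprD.
have -> : h ^+ (s + u) * f ^+ (s + u) * h ^+ t =
  h ^+ (s + t + u) * f ^+ (s + u) by rewrite mulrAC -exprD addnAC.
by rewrite -!scalerA E.
Qed.

Lemma loc_map_linear f g h : g = h * f -> linear (@loc_map f g h).
Proof.
move=> gE a x y; rewrite -[x]fracK -[y]fracK fracZ fracD !(loc_map_frac _ _ gE).
rewrite fracZ fracD; congr (frac _ _ _).
rewrite !scalerDr !scalerA; congr (_ *: _ + _ *: _); rewrite gE exprMn exprD; ring.
Qed.

End LocalizationMap.

(** * The Cech complex and local cohomology *)

Section Cech.
Variables (R : comNzRingType) (n : nat) (x : 'I_n -> R) (M : lmodType R).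
Implicit Types (s : {set 'I_n}) (j : nat).

Definition xprod s : R := \prod_(i in s) x i.

(* The direct sum of all the terms of the Cech complex of [M] on
   [x_0, ..., x_(n-1)]; the summands with [#|s| = j] form its [j]-th term. *)
Definition cech : Type := forall s, loc M (xprod s).
HB.instance Definition _ := Choice.on cech.

Definition cech_zero : cech := fun=> 0.
Definition cech_opp (c : cech) : cech := fun s => - c s.
Definition cech_add (b c : cech) : cech := fun s => b s + c s.
Definition cech_scale (a : R) (c : cech) : cech := fun s => a *: c s.

Lemma cech_addA : associative cech_add.
Proof. by move=> a b c; apply: functional_extensionality_dep => s; exact: addrA. Qed.
Lemma cech_addC : commutative cech_add.
Proof. by move=> a b; apply: functional_extensionality_dep => s; exact: addrC. Qed.
Lemma cech_add0 : left_id cech_zero cech_add.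
Proof. by move=> a; apply: functional_extensionality_dep => s; exact: add0r. Qed.
Lemma cech_addN : left_inverse cech_zero cech_opp cech_add.
Proof. by move=> a; apply: functional_extensionality_dep => s; exact: addNr. Qed.
HB.instance Definition _ :=
  GRing.isZmodule.Build cech cech_addA cech_addC cech_add0 cech_addN.

Lemma cech_scalerA a b c : cech_scale a (cech_scale b c) = cech_scale (a * b) c.
Proof. by apply: functional_extensionality_dep => s; exact: scalerA. Qed.
Lemma cech_scale1r : left_id 1 cech_scale.
Proof. by move=> c; apply: functional_extensionality_dep => s; exact: scale1r. Qed.
Lemma cech_scalerDr : right_distributive cech_scale +%R.
Proof. by move=> a b c; apply: functional_extensionality_dep => s; exact: scalerDr. Qed.
Lemma cech_scalerDl c : {morph cech_scale^~ c : a b / a + b}.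
Proof. by move=> a b; apply: functional_extensionality_dep => s; exact: scalerDl. Qed.
HB.instance Definition _ := GRing.Zmodule_isLmodule.Build R cech
  cech_scalerA cech_scale1r cech_scalerDr cech_scalerDl.

Lemma cechD (b c : cech) s : (b + c) s = b s + c s. Proof. by []. Qed.
Lemma cechZ a (c : cech) s : (a *: c) s = a *: c s. Proof. by []. Qed.

Definition cech_d (c : cech) : cech := fun s =>
  \sum_(i in s) (-1) ^+ #|[set j in s | (j < i)%N]| *:
    loc_map (xprod s) (x i) (c (s :\ i)).

Lemma cech_d_linear : linear cech_d.
Proof.
move=> a b c; apply: functional_extensionality_dep => s.
rewrite cechD cechZ /cech_d scaler_sumr -big_split /=.
apply: eq_bigr => i si; rewrite cechD cechZ.
have -> := @loc_map_linear R M (xprod (s :\ i)) (xprod s) (x i).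
  by rewrite scalerDr !scalerA mulrC.
by rewrite /xprod (big_setD1 i).
Qed.
HB.instance Definition _ := GRing.isLinear.Build R cech cech _ cech_d cech_d_linear.

Definition cocycles j : {pred cech} := fun c =>
  `[< (forall s, #|s| != j -> c s = 0) /\ cech_d c = 0 >].

Lemma cocycles_submod j : submod_closed (cocycles j).
Proof.
split; first by apply/asboolP; split=> //; exact: linear0.
move=> a b c /asboolP[b0 db] /asboolP[c0 dc]; apply/asboolP; split.
  by move=> s sj; rewrite cechD cechZ b0 // c0 // scaler0 addr0.
by rewrite cech_d_linear db dc scaler0 addr0.
Qed.
HB.instance Definition _ j :=
  GRing.isSubmodClosed.Build R cech (cocycles j)
    (GRing.submod_closed_semi (cocycles_submod j)).

Record cocycle j := Cocycle { cocycle_val :> cech; _ : cocycle_val \in cocycles j }.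
HB.instance Definition _ j := [isSub for @cocycle_val j].
HB.instance Definition _ j := [Choice of cocycle j by <:].
HB.instance Definition _ j := [SubChoice_isSubLmodule of cocycle j by <:].

Definition coboundaries j : {pred cocycle j} := fun c =>
  `[< exists b : cech, (forall s, #|s|.+1 != j -> b s = 0) /\ val c = cech_d b >].

Lemma coboundaries_submod j : submod_closed (@coboundaries j).
Proof.
split; first by apply/asboolP; exists 0; split=> //; rewrite linear0 raddf0.
move=> a u v /asboolP[b [b0 ub]] /asboolP[c [c0 vc]]; apply/asboolP.
exists (a *: b + c); split; last by rewrite cech_d_linear -ub -vc.
by move=> s sj; rewrite cechD cechZ b0 // c0 // scaler0 addr0.
Qed.
HB.instance Definition _ j :=
  GRing.isSubmodClosed.Build R (cocycle j) (@coboundaries j)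
    (GRing.submod_closed_semi (@coboundaries_submod j)).

(* The local cohomology of [M] with support in the ideal [(x_0, ..., x_(n-1))]. *)
Definition local_cohomology j := quotmod (@coboundaries j).
HB.instance Definition _ j := GRing.Lmodule.on (local_cohomology j).

End Cech.

(** * Gradings *)

(* The [Z]-gradings of modules over the standard graded polynomial ring.  Only
   [S_e M_d <= M_(d+e)] is recorded; that [M] is the direct sum of the [M_d] is
   left to the modules at hand. *)
Record grading (k : fieldType) (n : nat) (M : lmodType {mpoly k[n]}) := Grading {
  piece :> int -> M -> Prop;
  pieceM : forall d e (p : {mpoly k[n]}) u,
    piece d u -> p \is e.-homog -> piece (d + e%:Z) (p *: u)
}.

Section LocalCohomologyGrading.
Variables (k : fieldType) (n : nat).
Local Notation S := {mpoly k[n]}.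
Local Notation x := (fun i : 'I_n => 'X_i : S).
Variables (M : lmodType S) (gr : grading M).

(* [m / x_s ^+ t] has degree [d] when [m] has degree [d + t * #|s|]. *)
Definition loc_piece (s : {set 'I_n}) (d : int) (y : loc M (xprod x s)) : Prop :=
  exists m t, y = frac (xprod x s) m t /\ gr (d + (t * #|s|)%N%:Z) m.

(* The local cohomology with support in the irrelevant ideal. *)
Definition Hm (j : nat) := local_cohomology x M j.
HB.instance Definition _ j := GRing.Lmodule.on (Hm j).

Definition Hm_piece j (d : int) (h : Hm j) : Prop :=
  exists c : cocycle x M j, h = to_quotmod (@coboundaries S n x M j) c /\
    forall s, loc_piece d (val c s).

Fact Hm_pieceM j d e (p : S) h :
  Hm_piece (j := j) d h -> p \is e.-homog -> Hm_piece (d + e%:Z) (p *: h).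
Proof.
move=> [c [-> cd]] pe; exists (p *: c); split; first exact: quotmod_scaleE.
move=> s; have [m [t [E mt]]] := cd s; exists (p *: m), t; split.
  by rewrite linearZ /= cechZ E fracZ.
by rewrite addrAC; apply: pieceM.
Qed.
Definition Hm_grading j := Grading (@Hm_pieceM j).

End LocalCohomologyGrading.

(* The grading of [S / I] by the images of the homogeneous polynomials. *)
Section CyclicGrading.
Variables (k : fieldType) (n : nat) (I : submodClosed {mpoly k[n]}^o).

Definition cyclic_piece (d : int) (u : quotmod I) : Prop :=
  exists2 p : {mpoly k[n]}, u = to_quotmod I p
    & if d is Posz e then p \is e.-homog else p = 0.

Fact cyclic_pieceM d e (p : {mpoly k[n]}) u :
  cyclic_piece d u -> p \is e.-homog -> cyclic_piece (d + e%:Z) (p *: u).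
Proof.
move=> [q -> qd] pe; exists (p * q); first exact: quotmod_scaleE.
case: d qd => [d|d] qd; first by rewrite -PoszD addnC dhomogM.
by rewrite qd mulr0; case: (_ + _) => // m; exact: dhomog0.
Qed.
Definition cyclic_grading := Grading cyclic_pieceM.

End CyclicGrading.

(** * The graded dual of a graded module *)

Section GradedDual.
Variables (k : fieldType) (n : nat).
Local Notation S := {mpoly k[n]}.
Variables (H : lmodType S) (gr : grading H).

(* The [k]-linear forms vanishing on all but finitely many graded pieces:
   [Hom_k(H, k)] in the category of graded modules is the direct sum of the
   [Hom_k(H_d, k)]. *)
Definition is_graded_form (phi : H -> k) : Prop :=
  [/\ forall u v, phi (u + v) = phi u + phi v,
      forall c u, phi (c%:MP *: u) = c * phi u
    & exists D : seq int, forall d u, gr d u -> d \notin D -> phi u = 0].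

Record gdual := GDual { gdual_val :> H -> k; _ : `[< is_graded_form gdual_val >] }.
HB.instance Definition _ := [isSub for gdual_val].
HB.instance Definition _ := [Choice of gdual by <:].

Lemma gdualP (phi : gdual) : is_graded_form phi.
Proof. by case: phi => phi /= /asboolP. Qed.

Lemma gdual_eq (phi psi : gdual) : phi =1 psi -> phi = psi.
Proof. by move=> E; apply: val_inj; apply: funext. Qed.

Fact gdual_zero_subproof : `[< is_graded_form (fun=> 0) >].
Proof. by apply/asboolP; split=> [u v|c u|]; rewrite ?addr0 ?mulr0 //; exists [::]. Qed.
Definition gdual_zero := GDual gdual_zero_subproof.

Fact gdual_opp_subproof (phi : gdual) : `[< is_graded_form (fun u => - phi u) >].
Proof.
have [pD pZ [D p0]] := gdualP phi; apply/asboolP; split=> [u v|c u|].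
- by rewrite pD opprD.
- by rewrite pZ mulrN.
by exists D => d u du dD; rewrite (p0 d) ?oppr0.
Qed.
Definition gdual_opp phi := GDual (gdual_opp_subproof phi).

Fact gdual_add_subproof (phi psi : gdual) :
  `[< is_graded_form (fun u => phi u + psi u) >].
Proof.
have [pD pZ [D p0]] := gdualP phi; have [qD qZ [E q0]] := gdualP psi.
apply/asboolP; split=> [u v|c u|].
- by rewrite pD qD addrACA.
- by rewrite pZ qZ mulrDr.
exists (D ++ E) => d u du; rewrite mem_cat negb_or => /andP[dD dE].
by rewrite (p0 d) ?(q0 d) ?addr0.
Qed.
Definition gdual_add phi psi := GDual (gdual_add_subproof phi psi).

Fact gdual_scale_subproof (a : S) (phi : gdual) :
  `[< is_graded_form (fun u => phi (a *: u)) >].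
Proof.
have [pD pZ [D p0]] := gdualP phi; apply/asboolP; split=> [u v|c u|].
- by rewrite scalerDr pD.
- by rewrite scalerA mulrC -scalerA pZ.
exists [seq d - (mdeg m)%:Z | d <- D, m <- msupp a] => d u du dD.
have phi0 : phi 0 = 0 by have := pZ 0 0; rewrite scaler0 mul0r.
rewrite [a]mpolyE scaler_suml.
rewrite big_seq; elim/big_ind: _ => // [v w pv pw|m ma]; first by rewrite pD pv pw addr0.
rewrite -mul_mpolyC -scalerA pZ (p0 (d + (mdeg m)%:Z)) ?mulr0 //.
  by apply: pieceM => //; rewrite dhomogX.
apply: contra dD => dD; apply/allpairsP; exists (d + (mdeg m)%:Z, m).
by split=> //=; rewrite addrK.
Qed.
(* [H] being a module over a commutative ring, [a] acts on forms by transposition. *)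
Definition gdual_scale a phi := GDual (gdual_scale_subproof a phi).

Lemma gdual_addA : associative gdual_add.
Proof. by move=> f g h; apply: gdual_eq => u; exact: addrA. Qed.
Lemma gdual_addC : commutative gdual_add.
Proof. by move=> f g; apply: gdual_eq => u; exact: addrC. Qed.
Lemma gdual_add0 : left_id gdual_zero gdual_add.
Proof. by move=> f; apply: gdual_eq => u; exact: add0r. Qed.
Lemma gdual_addN : left_inverse gdual_zero gdual_opp gdual_add.
Proof. by move=> f; apply: gdual_eq => u; exact: addNr. Qed.
HB.instance Definition _ :=
  GRing.isZmodule.Build gdual gdual_addA gdual_addC gdual_add0 gdual_addN.

Lemma gdual_scalerA a b f : gdual_scale a (gdual_scale b f) = gdual_scale (a * b) f.
Proof. by apply: gdual_eq => u /=; rewrite scalerA mulrC. Qed.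
Lemma gdual_scale1r : left_id 1 gdual_scale.
Proof. by move=> f; apply: gdual_eq => u /=; rewrite scale1r. Qed.
Lemma gdual_scalerDr : right_distributive gdual_scale +%R.
Proof. by move=> a f g; apply: gdual_eq. Qed.
Lemma gdual_scalerDl f : {morph gdual_scale^~ f : a b / a + b}.
Proof.
move=> a b; apply: gdual_eq => u /=; rewrite scalerDl.
by have [fD _ _] := gdualP f; rewrite fD.
Qed.
HB.instance Definition _ := GRing.Zmodule_isLmodule.Build S gdual
  gdual_scalerA gdual_scale1r gdual_scalerDr gdual_scalerDl.

End GradedDual.

(** * S_r-depth *)

(* The least element of a set of natural numbers, [None] standing for
   [min set0 = +oo]. *)
Definition min_nat (A : nat -> Prop) : option nat :=
  if pselect (exists j, `[< A j >]) is left ex then Some (ex_minn ex) else None.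

Definition le_oo (a b : option nat) : bool :=
  match a, b with
  | _, None => true
  | None, Some _ => false
  | Some a, Some b => (a <= b)%N
  end.

Section Depth.
Variables (k : fieldType) (n : nat) (M : lmodType {mpoly k[n]}) (gr : grading M).

Definition K_module (j : nat) := gdual (Hm_grading gr j).
HB.instance Definition _ j := GRing.Lmodule.on (K_module j).

Definition S_depth (r : nat) : option nat :=
  min_nat (fun j => krull_dim_ge (K_module j) (j%:Z - r%:Z + 1)).

End Depth.

(* The [S_r]-depth of [S / I], for a homogeneous ideal [I] of [S]. *)
Definition cyclic_S_depth (k : fieldType) (n : nat) (r : nat)
  (I : submodClosed {mpoly k[n]}^o) : option nat := S_depth (cyclic_grading I) r.

(** * Cover ideals *)

Definition vertex_cover (n : nat) (e : rel 'I_n) (C : {set 'I_n}) : bool :=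
  [forall i, forall j, e i j ==> (i \in C) || (j \in C)].

Definition cover_ideal (k : fieldType) (n : nat) (e : rel 'I_n) :
    {pred {mpoly k[n]}} :=
  ideal_gen (fun f => exists2 C : {set 'I_n},
    vertex_cover e C & f = \prod_(i in C) 'X_i).
Arguments cover_ideal k {n} e.

(* Main.v *)
(** Let [r a = a + 1] if [2 a >= l] and [r a = a] otherwise.  For integers [a, b],
    [a + b >= l] holds if and only if [r a + r b >= l + 1], and [r] preserves
    signs.  Since [J^(l)] is spanned by the monomials [x^m] with
    [m_i + m_j >= l] for all edges [ij], the part of multidegree [a] of the Cech
    complex of [S / J^(l)] is the part of multidegree [r a] of that of
    [S / J^(l+1)].  As [r] is strictly increasing, [r (a + u) - r a >= u]:
    multiplication by [x^u] out of degree [a] becomes multiplication by a multiple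
    of [x^u] out of degree [r a].  A polynomial annihilating [K^j] for
    [S / J^(l+1)] therefore annihilates [K^j] for [S / J^(l)], so that the
    dimensions of the modules [K^j] can only grow from [l] to [l + 1]. *)

Require Import Defs.
From HB Require Import structures.
From mathcomp Require Import mpoly.
From mathcomp Require Import all_boot all_order all_algebra.
From mathcomp Require Import boolp zify.

Set Implicit Arguments.
Unset Strict Implicit.
Unset Printing Implicit Defensive.

Import Defs.
Import Order.TTheory GRing.Theory Num.Theory.
Local Open Scope ring_scope.
Local Open Scope quotient_scope.

(** * Powers of the prime ideals generated by variables *)

Section WeightedIdeals.
Variables (k : fieldType) (n : nat).
Local Notation S := {mpoly k[n]}.
Implicit Types (A : {set 'I_n}) (m : 'X_{1..n}) (p q : S) (c : nat).

Definition weight A m : nat := (\sum_(v in A) m v)%N.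

(** By [ideal_pow_weight] this is the [c]-th power of the ideal generated by the variables in [A],
    in a form that can be tested on exponents. *)
Definition weight_ge A c : {pred S} := fun p => all (fun m => c <= weight A m)%N (msupp p).

Lemma weight_geP A c p :
  reflect (forall m, m \in msupp p -> (c <= weight A m)%N) (p \in weight_ge A c).
Proof. exact: allP. Qed.

Lemma weightD A m m' : weight A (m + m')%MM = (weight A m + weight A m')%N.
Proof. by rewrite -big_split; apply: eq_bigr => v _; rewrite mnmDE. Qed.

Lemma weight_ge0 A c : 0 \in weight_ge A c.
Proof. by apply/weight_geP => m; rewrite mcoeff_msupp mcoeff0 eqxx. Qed.

Lemma weight_geD A c p q :
  p \in weight_ge A c -> q \in weight_ge A c -> p + q \in weight_ge A c.
Proof.
move=> /weight_geP hp /weight_geP hq; apply/weight_geP => m /msuppD_le.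
by rewrite mem_cat => /orP[/hp|/hq].
Qed.

Lemma weight_geM A c d p q :
  p \in weight_ge A c -> q \in weight_ge A d -> p * q \in weight_ge A (c + d).
Proof.
move=> /weight_geP hp /weight_geP hq; apply/weight_geP => m /msuppM_le.
by move=> /allpairsP[[u v] /= [/hp hu /hq hv ->]]; rewrite weightD leq_add.
Qed.

Lemma weight_geMl A c p q : q \in weight_ge A c -> p * q \in weight_ge A c.
Proof. by move=> hq; apply: (@weight_geM A 0) => //; apply/weight_geP. Qed.

Lemma weight_geX A c m : ('X_[m] \in weight_ge A c) = (c <= weight A m)%N.
Proof.
apply/weight_geP/idP => [|h m']; first by apply; rewrite msuppX mem_head.
by rewrite msuppX mem_seq1 => /eqP->.
Qed.

Lemma weight_ge_prod A (r : seq S) :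
  {subset r <= weight_ge A 1} -> \prod_(g <- r) g \in weight_ge A (size r).
Proof.
elim: r => [|g r IH] h; first by rewrite big_nil; apply/weight_geP.
rewrite big_cons; apply: (@weight_geM A 1); first by apply: h; rewrite mem_head.
by apply: IH => x xr; apply: h; rewrite in_cons xr orbT.
Qed.

Lemma mpolyX_split A m : (0 < weight A m)%N ->
  exists2 v, v \in A & (m = (m - U_(v)) + U_(v))%MM.
Proof.
rewrite lt0n sum_nat_eq0 negb_forall => /existsP[v].
rewrite negb_imply => /andP[vA mv]; exists v => //.
by rewrite submK // lep1mP.
Qed.

(** Substitution of [0] for the variables in [A]. Its kernel is [weight_ge A 1], which is therefore
    a prime ideal. *)
Definition subst0 A : S -> S :=
  mmap (@mpolyC n k) (fun v => if v \in A then 0 else 'X_v).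

Lemma subst0X A m : subst0 A 'X_[m] = if weight A m == 0%N then 'X_[m] else 0.
Proof.
rewrite /subst0 mmapX /mmap1; case: ifP => [|/negbT].
  rewrite sum_nat_eq0 => /forallP h; rewrite mpolyXE_id; apply: eq_bigr => v _.
  by have := h v; case: ifP => //= _ /eqP->; rewrite !expr0.
rewrite sum_nat_eq0 negb_forall => /existsP[v].
rewrite negb_imply => /andP[vA mv].
by rewrite (bigD1 v) //= vA expr0n (negPf mv) mul0r.
Qed.

(** The substitution removes the terms of positive weight and fixes the others, so no cancellation
    can occur. *)
Lemma weight_ge1E A p : (p \in weight_ge A 1) = (subst0 A p == 0).
Proof.
have subst0E : subst0 A p = \sum_(m <- msupp p | weight A m == 0%N) p@_m *: 'X_[m].
  rewrite {1}[p]mpolyE /subst0 raddf_sum /= [RHS]big_mkcond /=; apply: eq_bigr => m _.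
  rewrite mmapZ -/(subst0 A 'X_[m]) subst0X mul_mpolyC.
  by case: ifP; rewrite ?scaler0.
rewrite subst0E; apply/weight_geP/eqP => [h|/mpolyP h m mp].
  rewrite big_seq_cond big_pred0 // => m; apply/negbTE/negP => /andP[/h].
  by case: (weight A m).
rewrite lt0n; apply/negP => w0; have := h m; rewrite raddf_sum mcoeff0 /=.
rewrite big_mkcond (bigD1_seq m) ?msupp_uniq //= w0 mcoeffZ mcoeffX eqxx mulr1.
rewrite big1 => [|m' m'm].
  by move/eqP; rewrite addr0 mcoeff_eq0 mp.
by case: ifP => // _; rewrite mcoeffZ mcoeffX (negPf m'm) mulr0.
Qed.

Fact weight_ge1_ideal A : idealr_closed (weight_ge A 1).
Proof.
split=> [||a u v hu hv]; first exact: weight_ge0.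
  by rewrite -mpolyX0 weight_geX -ltnNge ltnS leqn0 sum_nat_eq0; apply/forallP => v;
    rewrite mnm0E eqxx implybT.
by apply: weight_geD => //; exact: weight_geMl.
Qed.

Fact weight_ge1_prime A : prime_idealr_closed (weight_ge A 1).
Proof. by move=> u v; rewrite !weight_ge1E /subst0 rmorphM mulf_eq0. Qed.

HB.instance Definition _ A := isIdealr.Build S (weight_ge A 1) (weight_ge1_ideal A).
HB.instance Definition _ A :=
  isPrimeIdealrClosed.Build S (weight_ge A 1) (@weight_ge1_prime A).

Lemma ideal_genP (R : comNzRingType) (X : R -> Prop) f :
  f \in ideal_gen X <->
  exists s : seq (R * R), (forall x, x \in s -> X x.2) /\ f = \sum_(x <- s) x.1 * x.2.
Proof. by split => [/asboolP|h]; last exact/asboolP. Qed.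

Lemma ideal_genM (R : comNzRingType) (X : R -> Prop) a g : X g -> a * g \in ideal_gen X.
Proof.
move=> Xg; apply/ideal_genP; exists [:: (a, g)]; split; last by rewrite big_seq1.
by move=> x; rewrite inE => /eqP->.
Qed.

Lemma ideal_gen_monomials (X : S -> Prop) p :
  (forall m, m \in msupp p -> 'X_[m] \in ideal_gen X) -> p \in ideal_gen X.
Proof.
move=> h; rewrite [p]mpolyE big_seq; apply: rpred_sum => m /h hm.
by rewrite -mul_mpolyC; exact: (@rpredZ _ S^o (ideal_gen X) (p@_m)%:MP _ hm).
Qed.

Lemma ideal_pow_weight A (P : {pred S}) c p : P =i weight_ge A 1 ->
  (p \in ideal_pow P c) = (p \in weight_ge A c).
Proof.
move=> PE; apply/idP/idP => [/ideal_genP[s [sX ->]]|/weight_geP hp].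
  rewrite big_seq; elim/big_ind: _ => [|u v hu hv|[a g] /sX[t [tP /= ->]]].
  - exact: weight_ge0.
  - exact: weight_geD.
  rewrite weight_geMl // -[c in weight_ge A c](size_tuple t) weight_ge_prod //.
  by move=> g' /tP; rewrite PE.
apply: ideal_gen_monomials => m /hp {hp p}.
(* A monomial of weight at least [c] is a product of [c] variables in [A] and a cofactor; the
   variables are peeled off one by one. *)
suff h : (c <= weight A m)%N -> exists (t : c.-tuple S) m',
    {subset t <= P} /\ 'X_[m] = 'X_[m'] * \prod_(g <- t) g :> S.
  by move=> /h[t [m' [tP ->]]]; apply: ideal_genM; exists t.
elim: c m => [|c IH] m hm.
  by exists [tuple], m; split=> //; rewrite big_nil mulr1.
have [v vA mE] := mpolyX_split (leq_trans (ltn0Sn c) hm).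
have [|t [m' [tP m'E]]] := IH (m - U_(v))%MM.
  move: hm; rewrite {1}mE weightD.
  rewrite [weight A U_(v)](_ : _ = 1%N) ?addn1 //.
  rewrite /weight (bigD1 v) //= mnm1E eqxx big1 // => i /andP[_ iv].
  by rewrite mnm1E eq_sym (negPf iv).
exists [tuple of 'X_v :: t], m'; split.
  move=> g; rewrite in_cons => /orP[/eqP->|/tP //].
  rewrite PE weight_geX /weight (bigD1 v) //= mnm1E eqxx; exact: leq_addr.
by rewrite big_cons {1}mE mpolyXD m'E -mulrA (mulrC 'X_v).
Qed.

End WeightedIdeals.

(** * Associated primes and symbolic powers of the cover ideal *)

Section CoverIdeals.
Variables (k : fieldType) (n : nat) (e : rel 'I_n).
Hypothesis e_irr : irreflexive e.
Local Notation S := {mpoly k[n]}.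
Local Notation J := (cover_ideal k e).
Local Notation edge i j := (@weight_ge k n [set i; j]).

Lemma weight_edge i j (m : 'X_{1..n}) : e i j -> weight [set i; j] m = (m i + m j)%N.
Proof.
move=> eij; rewrite /weight big_setU1 ?big_set1 // inE.
by apply/eqP => ij; rewrite ij e_irr in eij.
Qed.

Lemma prod_mpolyX (C : {set 'I_n}) :
  \prod_(i in C) 'X_i = 'X_[[multinom (i \in C : nat) | i < n]] :> S.
Proof.
rewrite mpolyXE_id big_mkcond; apply: eq_bigr => i _.
by rewrite mnmE; case: (i \in C); rewrite ?expr0 ?expr1.
Qed.

Lemma cover_idealP p :
  reflect (forall i j, e i j -> p \in edge i j 1) (p \in J).
Proof.
apply: (iffP idP) => [/ideal_genP[s [sX ->]] i j eij|hp].
  rewrite big_seq; elim/big_ind: _ => [|u v hu hv|[a g] /sX[C hC /= ->]].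
  - exact: weight_ge0.
  - exact: weight_geD.
  rewrite weight_geMl // prod_mpolyX weight_geX weight_edge // !mnmE.
  have /forallP/(_ i)/forallP/(_ j) := hC; rewrite eij /=.
  by case: (i \in C); case: (j \in C).
(* The support [C] of a monomial lying in all edge primes is a vertex cover, and the squarefree
   monomial on [C] divides it. *)
apply: ideal_gen_monomials => m mp; pose C := [set i | m i != 0%N].
have -> : m = ((m - [multinom (i \in C : nat) | i < n]) +
               [multinom (i \in C : nat) | i < n])%MM.
  rewrite submK //; apply/mnm_lepP => i; rewrite mnmE inE.
  by case: (m i).
rewrite mpolyXD -prod_mpolyX; apply: ideal_genM; exists C => //.
apply/forallP => i; apply/forallP => j; apply/implyP => eij.
have /weight_geP/(_ m mp) := hp i j eij; rewrite weight_edge // !inE.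
by case: (m i) => [|?] //; case: (m j).
Qed.

(** The edge prime is [J : x^m] for [x^m] the product of all variables other than those of [i] and
    [j]: this monomial lies in the prime of every edge except [ij]. *)
Lemma is_ass_edge i j : e i j -> is_ass J (edge i j 1).
Proof.
move=> eij; pose m := [multinom (v \notin [set i; j] : nat) | v < n].
have m_edge v w : e v w -> weight [set v; w] m = 0%N -> [set v; w] = [set i; j].
  move=> evw; rewrite weight_edge // !mnmE => /eqP.
  rewrite addn_eq0 !eqb0 !negbK => /andP[vij wij].
  apply/eqP; rewrite eqEcard subUset !sub1set vij wij /= !cards2.
  have -> : i != j by apply/eqP => ij; rewrite ij e_irr in eij.
  by case: eqP => // vw; rewrite vw e_irr in evw.
exists 'X_[m] => a; apply/idP/cover_idealP => [ha v w evw|h].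
  have [w0|w0] := posnP (weight [set v; w] m).
    by rewrite (m_edge v w) // mulrC; exact: weight_geMl.
  by rewrite weight_geMl // weight_geX.
have := h i j eij; rewrite (prime_idealrM (edge i j 1)) weight_geX => /orP[//|].
by rewrite weight_edge // !mnmE !inE !eqxx orbT.
Qed.

(** Suppose [P = J : f] is no edge prime. It is contained in the prime of each edge that excludes
    [f], so some variable of that edge is outside [P]. The product [q] of these variables is outside
    the prime [P], yet [q * f] lies in every edge prime, hence in [J]. *)
Lemma is_assP (P : prime_idealr S) :
  is_ass J P -> exists i j, e i j /\ P =i edge i j 1.
Proof.
move=> [f hf]; apply: contrapT => no.
have sub i j : e i j -> f \notin edge i j 1 -> exists2 v, v \in [set i; j] & 'X_v \notin P.
  move=> eij fij; apply: contrapT => all_in; apply: no; exists i, j; split=> // a.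
  apply/idP/idP => [|/weight_geP ha].
    rewrite hf => /cover_idealP/(_ i j eij).
    by rewrite (prime_idealrM (edge i j 1)) (negPf fij) orbF.
  rewrite [a]mpolyE big_seq; apply: rpred_sum => m /ha /mpolyX_split[v vij ->].
  rewrite -mul_mpolyC mpolyXD !idealMr //; apply: contrapT => /negP vP.
  by apply: all_in; exists v.
pose g (x : 'I_n * 'I_n) := [pick v in [set x.1; x.2] | ('X_v : S) \notin P].
(* For the edges in this product [sub] provides a variable, so the default [1] is never taken. *)
pose q : S := \prod_(x | e x.1 x.2 && (f \notin edge x.1 x.2 1))
                if g x is Some v then 'X_v else 1.
have /negP[] : q \notin P.
  rewrite /q; elim/big_ind: _ => [|u v hu hv|x /andP[ex fx]].
  - by rewrite (idealr1 P).
  - by rewrite (prime_idealrM P) negb_or hu.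
  by rewrite /g; case: pickP => [v /andP[] //|_]; rewrite (idealr1 P).
rewrite hf; apply/cover_idealP => i j eij.
have [fij|fij] := boolP (f \in edge i j 1); first exact: weight_geMl.
rewrite mulrC weight_geMl // /q (bigD1 (i, j)) /= ?eij // mulrC weight_geMl //.
rewrite /g; case: pickP => [v /andP[vij _]|]; last first.
  by have [v vij vP] := sub i j eij fij => /(_ v); rewrite vij vP.
rewrite weight_geX /weight (bigD1 v) //= mnm1E eqxx; exact: leq_addr.
Qed.

(** The associated primes of [J] are exactly the edge primes, so the symbolic power is cut out by
    one weight condition per edge. *)
Lemma symbolic_pow_cover_idealP l p :
  p \in symbolic_pow J l <->
  forall m, m \in msupp p -> forall i j, e i j -> (l <= m i + m j)%N.
Proof.
split=> [/asboolP h m mp i j eij|h].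
  have := h _ (is_ass_edge eij); rewrite (ideal_pow_weight _ _ (fun=> erefl)).
  by move/weight_geP/(_ m mp); rewrite weight_edge.
apply/asboolP => P /is_assP[i [j [eij PE]]]; rewrite (ideal_pow_weight _ _ PE).
by apply/weight_geP => m mp; rewrite weight_edge //; exact: h.
Qed.

End CoverIdeals.

(** * Coefficients at integer exponent vectors *)

Section Exponents.
Variables (k : fieldType) (n : nat).
Local Notation S := {mpoly k[n]}.
Implicit Types (F G : 'I_n -> int) (p q : S).

Definition expo F : 'X_{1..n} := [multinom `|F i|%N | i < n].

(* The coefficient of a monomial with exponents in [Z], hence [0] when one of
   them is negative. *)
Definition coef_int F p : k := if [forall i, 0 <= F i] then p@_(expo F) else 0.

Lemma expo_nat F (u : 'X_{1..n}) : (forall i, F i = (u i)%:Z) -> expo F = u.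
Proof. by move=> FE; apply/mnmP => i; rewrite mnmE FE absz_nat. Qed.

Lemma coef_int_nat F (u : 'X_{1..n}) p :
  (forall i, F i = (u i)%:Z) -> coef_int F p = p@_u.
Proof.
move=> FE; rewrite /coef_int (expo_nat FE).
by have -> : [forall i, 0 <= F i] by apply/forallP => i; rewrite FE.
Qed.

Lemma coef_intP F p : coef_int F p != 0 -> forall i, 0 <= F i.
Proof. by rewrite /coef_int; case: forallP => //; rewrite eqxx. Qed.

Lemma coef_intD F p q : coef_int F (p + q) = coef_int F p + coef_int F q.
Proof. by rewrite /coef_int; case: ifP; rewrite ?mcoeffD ?addr0. Qed.

Lemma coef_intZ F c p : coef_int F (c%:MP * p) = c * coef_int F p.
Proof. by rewrite /coef_int; case: ifP; rewrite ?mcoeffCM ?mulr0. Qed.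

Lemma coef_int_mulX F G (u : 'X_{1..n}) p : (forall i, G i = F i + (u i)%:Z) ->
  coef_int G ('X_[u] * p) = coef_int F p.
Proof.
move=> GE; rewrite mulrC /coef_int.
have [/forallP hF|] := boolP [forall i, 0 <= F i].
  have -> : [forall i, 0 <= G i].
    by apply/forallP => i; rewrite GE addr_ge0.
  rewrite (_ : expo G = u + expo F)%MM ?mcoeffMX //.
  by apply/mnmP => i; rewrite mnmDE !mnmE GE; have := hF i; lia.
(* If [F] has a negative entry and [G] has none, then [x^G] is not divisible by [x^u], so it does
   not occur in a multiple of [x^u]. *)
rewrite negb_forall => /existsP[i Fi]; case: forallP => // hG.
apply: memN_msupp_eq0; rewrite (perm_mem (msuppMX p u)).
apply/mapP => -[m _] /mnmP/(_ i); rewrite mnmDE mnmE.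
by have := hG i; rewrite GE; lia.
Qed.

End Exponents.

(** * Multigraded pieces of the localizations of [S / J^(l)] *)

Section FineDegrees.
Variables (k : fieldType) (n : nat) (e : rel 'I_n).
Local Notation S := {mpoly k[n]}.
Local Notation x := (fun i : 'I_n => 'X_i : S).
Local Notation deg := {ffun 'I_n -> int}.
Implicit Types (s : {set 'I_n}) (a b : deg) (t l : nat) (p q : S).

(* The exponents of the numerator of [x^a] over [x_s^t]. *)
Definition chart s t a : 'I_n -> int := fun i => a i + (t * (i \in s))%N%:Z.

(** An exponent of [x_s] large enough to clear the denominators of [x^a], whatever [s] is. *)
Definition bound a : nat := (\sum_i `|a i|)%N.

(** The condition for [x^a] to exist in the localization of [S] at [x_s]. *)
Definition nonneg_off s a := [forall i, (i \notin s) ==> (0 <= a i)].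

(* [x^a] vanishes in the localization of [S / J^(l)] at [x_s]. *)
Definition vanishing l s a :=
  [forall i, forall j, [&& e i j, i \notin s & j \notin s] ==> (l%:Z <= a i + a j)].

Lemma vanishingP l s a : reflect
  (forall i j, e i j -> i \notin s -> j \notin s -> l%:Z <= a i + a j)
  (vanishing l s a).
Proof.
apply: (iffP forallP) => [h i j eij si sj|h i].
  by have /forallP/(_ j) := h i; rewrite eij si sj.
by apply/forallP => j; apply/implyP => /and3P[]; exact: h.
Qed.

Lemma xprodX s t : xprod x s ^+ t = 'X_[[multinom (t * (i \in s))%N | i < n]].
Proof.
rewrite /xprod prod_mpolyX mpolyXn; congr 'X_[_].
by apply/mnmP => i; rewrite mulmnE !mnmE mulnC.
Qed.

Lemma chart_ge0 s t a : (forall i, 0 <= chart s t a i) -> nonneg_off s a.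
Proof.
move=> h; apply/forallP => i; apply/implyP => si.
by have := h i; rewrite /chart (negPf si) muln0 addr0.
Qed.

Lemma chart_bound_ge0 s a : nonneg_off s a -> forall i, 0 <= chart s (bound a) a i.
Proof.
move=> /forallP h i; rewrite /chart; have := h i.
have : (`|a i| <= bound a)%N by rewrite /bound (bigD1 i) //= leq_addr.
by case: (i \in s); lia.
Qed.

(** The description of [J^(l)] by exponents; the multigraded arguments below use the symbolic powers
    only through it. *)
Definition cover_power (l : nat) (I : {pred S}) : Prop := forall p, p \in I <->
  forall m, m \in msupp p -> forall i j, e i j -> (l <= m i + m j)%N.

Section CechCoefficients.
Variables (l : nat) (I : submodClosed S^o).
Hypothesis I_mem : cover_power l I.
Local Notation pi := (to_quotmod I).
Local Notation Loc s := (loc (quotmod I) (xprod x s)).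

Lemma to_quotmodZ p q : p *: pi q = pi (p * q).
Proof. exact: quotmod_scaleE. Qed.

Lemma to_quotmod_eq0 p : p \in I -> pi p = 0.
Proof.
move=> pI; rewrite -[RHS](raddf0 (\pi_(Quotient.quot (zmod_pred I)))).
by apply/to_quotmodE; rewrite subr0.
Qed.

Lemma to_quotmod_sum (J : Type) (r : seq J) (F : J -> S) :
  \sum_(j <- r) pi (F j) = pi (\sum_(j <- r) F j).
Proof.
elim: r => [|j r IH]; last by rewrite !big_cons IH to_quotmodD.
by rewrite !big_nil to_quotmod_eq0 // (rpred0 I).
Qed.

Lemma loc_reprP s (y : Loc s) : exists p t, y = frac (xprod x s) (pi p) t.
Proof.
exists (repr (numer y : Quotient.quot (zmod_pred I))), (denom y).
by rewrite to_quotmod_repr fracK.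
Qed.

(** The coefficient is read off a chosen fraction, and [coef_frac] shows that any other gives the
    same value. Where [x^a] vanishes the coefficient would depend on the choice, hence the value
    [0]. *)
Definition coef s a (y : Loc s) : k :=
  if vanishing l s a then 0 else
  coef_int (chart s (denom y) a) (repr (numer y : Quotient.quot (zmod_pred I))).

(* The image of [x^a], meaningful only when [a] is nonnegative off [s]. *)
Definition mono s a : Loc s :=
  frac (xprod x s) (pi 'X_[expo (chart s (bound a) a)]) (bound a).

Lemma coef_int_chart s r t a p :
  coef_int (chart s (r + t) a) (xprod x s ^+ r * p) = coef_int (chart s t a) p.
Proof.
rewrite xprodX; apply: coef_int_mulX => i.
by rewrite mnmE /chart mulnDl PoszD addrA addrAC.
Qed.

(** Multiplication by [x_s^t] leaves the exponents off [s] unchanged, so the edge inequalities for a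
    monomial of [p] give those for [a] on the edges that avoid [s]. *)
Lemma coef_int_ideal s t a p :
  p \in I -> ~~ vanishing l s a -> coef_int (chart s t a) p = 0.
Proof.
move=> /I_mem hp; apply: contraNeq => nz; have c0 := coef_intP nz.
apply/vanishingP => i j eij si sj; move: nz.
rewrite /coef_int (introT forallP c0) -mcoeff_msupp => /hp/(_ i j eij).
rewrite !mnmE; have := c0 i; have := c0 j.
by rewrite /chart (negPf si) (negPf sj) !muln0 !addr0; lia.
Qed.

(** Two numerators of the same fraction differ, over a common denominator, by an element of [I],
    which has no coefficient at a nonvanishing [a]. *)
Lemma coef_frac s a p t : coef a (frac (xprod x s) (pi p) t) =
  if vanishing l s a then 0 else coef_int (chart s t a) p.
Proof.
rewrite /coef; case: ifP => // /negbT va.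
set y := frac _ _ _; have [r] := frac_repr (xprod x s) (pi p) t.
rewrite -/y -{1}[numer y]to_quotmod_repr !to_quotmodZ.
move: (repr _) (denom y) => q t' /to_quotmodE d.
rewrite -(coef_int_chart s (r + t) t' a q) -(coef_int_chart s (r + t') t a p).
have -> : (r + t' + t = r + t + t')%N by rewrite addnAC.
apply/eqP; rewrite eq_sym -subr_eq0 -[X in _ - X]mul1r -mulN1r mulrA mulr1.
by rewrite -coef_intZ -coef_intD mpolyCN mpolyC1 mulN1r coef_int_ideal.
Qed.

Lemma coefD s a (y z : Loc s) : coef a (y + z) = coef a y + coef a z.
Proof.
have [p [t ->]] := loc_reprP y; have [q [t' ->]] := loc_reprP z.
rewrite fracD !to_quotmodZ -to_quotmodD !coef_frac; case: ifP; rewrite ?addr0 //.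
by rewrite coef_intD coef_int_chart addnC coef_int_chart.
Qed.

Lemma coefZ s a c (y : Loc s) : coef a (c%:MP *: y) = c * coef a y.
Proof.
have [p [t ->]] := loc_reprP y; rewrite fracZ to_quotmodZ !coef_frac.
by case: ifP; rewrite ?mulr0 // coef_intZ.
Qed.

Lemma coef0 s a : coef a (0 : Loc s) = 0.
Proof. by rewrite -(scale0r (0 : Loc s)) -mpolyC0 coefZ mul0r. Qed.

Lemma coef_eq0 s a (y : Loc s) : ~~ nonneg_off s a -> coef a y = 0.
Proof.
have [p [t ->]] := loc_reprP y; rewrite coef_frac; case: ifP => // _.
by apply: contraNeq => /coef_intP; exact: chart_ge0.
Qed.

Lemma monoE s t a : (forall i, 0 <= chart s t a i) ->
  mono s a = frac (xprod x s) (pi 'X_[expo (chart s t a)]) t.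
Proof.
move=> h; have h' := chart_bound_ge0 (chart_ge0 h).
apply/fracE; exists 0%N; rewrite !add0n !to_quotmodZ !xprodX -!mpolyXD.
congr (pi 'X_[_]); apply/mnmP => i; rewrite !mnmDE !mnmE.
by have := h i; have := h' i; rewrite /chart; case: (i \in s); rewrite ?muln1 ?muln0; lia.
Qed.

Lemma mono_eq0 s a : vanishing l s a -> nonneg_off s a -> mono s a = 0.
Proof.
move=> /vanishingP va sa; have h := chart_bound_ge0 sa.
(* The factor [x_s^l] settles the edges that meet [s]; the other edges are covered by [va]. *)
apply/fracE; exists l; rewrite scaler0 addn0 to_quotmodZ xprodX -mpolyXD.
apply: to_quotmod_eq0; apply/I_mem => m.
rewrite msuppX mem_seq1 => /eqP-> i j eij; rewrite !mnmDE !mnmE.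
have := h i; have := h j; have := va i j eij; rewrite /chart.
by case: (i \in s); case: (j \in s) => //=; rewrite ?muln1 ?muln0; lia.
Qed.

Lemma mulX_mono s a b (u : 'X_{1..n}) : nonneg_off s a ->
  (forall i, b i = a i + (u i)%:Z) -> 'X_[u] *: mono s a = mono s b.
Proof.
move=> sa bE; have h := chart_bound_ge0 sa.
have h' i : 0 <= chart s (bound a) b i.
  by have := h i; rewrite /chart bE; lia.
rewrite (monoE h') fracZ to_quotmodZ -mpolyXD.
congr (frac _ (pi 'X_[_]) _); apply/mnmP => i; rewrite mnmDE !mnmE.
by have := h i; have := h' i; rewrite /chart bE; lia.
Qed.

Lemma coef_mono s a b (u : 'X_{1..n}) g : nonneg_off s a ->
  (forall i, b i = a i + (u i)%:Z) ->
  coef b (g *: mono s a) = if vanishing l s b then 0 else g@_u.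
Proof.
move=> sa bE; have h := chart_bound_ge0 sa.
rewrite fracZ to_quotmodZ coef_frac; case: ifP => // _.
rewrite mulrC (@coef_int_mulX _ _ (fun i => (u i)%:Z)); first exact: coef_int_nat.
by move=> i; have := h i; rewrite mnmE /chart bE; lia.
Qed.

Lemma setD1_chart s i t a v : i \in s ->
  chart s t a v = chart (s :\ i) t a v + (t * (v == i))%N%:Z.
Proof.
by move=> si; rewrite /chart !inE; case: eqP => [->|]; rewrite ?si /=; lia.
Qed.

Lemma mpolyXUn i t : 'X_i ^+ t = 'X_[[multinom (t * (v == i))%N | v < n]] :> S.
Proof.
rewrite mpolyXn; congr 'X_[_]; apply/mnmP => v.
by rewrite mulmnE mnm1E mnmE eq_sym mulnC.
Qed.

Lemma xprodD1 s i : i \in s -> xprod x s = 'X_i * xprod x (s :\ i).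
Proof. by move=> si; rewrite /xprod (big_setD1 i). Qed.

Lemma coef_loc_map s i a (y : Loc (s :\ i)) : i \in s ->
  coef a (loc_map (xprod x s) ('X_i) y) = if vanishing l s a then 0 else coef a y.
Proof.
move=> si; have [p [t ->]] := loc_reprP y.
rewrite (loc_map_frac _ _ (xprodD1 si)) to_quotmodZ !coef_frac.
case: ifP => // /negbT va.
(* Every edge avoiding [s] avoids [s :\ i], so vanishing persists under further localization. *)
have /negbTE-> : ~~ vanishing l (s :\ i) a.
  apply: contra va => /vanishingP h; apply/vanishingP => v w evw sv sw.
  by apply: h; rewrite // inE negb_and ?sv ?sw orbT.
rewrite mpolyXUn; apply: coef_int_mulX => v.
by rewrite mnmE; exact: setD1_chart.
Qed.

Lemma loc_map_mono s i a : i \in s -> nonneg_off (s :\ i) a ->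
  loc_map (xprod x s) ('X_i) (mono (s :\ i) a) = mono s a.
Proof.
move=> si sa; rewrite (loc_map_frac _ _ (xprodD1 si)) to_quotmodZ mpolyXUn -mpolyXD.
have h := chart_bound_ge0 sa.
congr (frac _ (pi 'X_[_]) _); apply/mnmP => v; rewrite mnmDE !mnmE.
by rewrite (setD1_chart _ _ _ si); have := h v; lia.
Qed.

Lemma frac_sum s (J : Type) (r : seq J) (F : J -> quotmod I) t :
  \sum_(j <- r) frac (xprod x s) (F j) t = frac (xprod x s) (\sum_(j <- r) F j) t.
Proof.
elim: r => [|j r IH]; last by rewrite !big_cons IH fracDl.
by rewrite !big_nil; apply/fracE; exists 0%N; rewrite !scaler0.
Qed.

(** The multidegree of [x^m / x_s^t], inverse to [chart]. *)
Definition fine_degree s t (m : 'X_{1..n}) : deg :=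
  [ffun i => (m i)%:Z - (t * (i \in s))%N%:Z].

Lemma chart_fine_degree s t m i : chart s t (fine_degree s t m) i = (m i)%:Z.
Proof. by rewrite /chart ffunE subrK. Qed.

(** [A] may exceed the degrees of [p], the additional terms being zero; one list can thus serve all
    summands of the Cech complex. *)
Lemma fine_decomposition s p t (A : seq deg) : uniq A ->
  {subset [seq fine_degree s t m | m <- msupp p] <= A} ->
  \sum_(a <- A) (coef a (frac (xprod x s) (pi p) t))%:MP *: mono s a =
  frac (xprod x s) (pi p) t.
Proof.
move=> uA sA.
transitivity (\sum_(a <- A) frac (xprod x s)
    (pi ((coef_int (chart s t a) p)%:MP * 'X_[expo (chart s t a)])) t).
  apply: eq_bigr => a _; rewrite coef_frac.
  have [c0|/coef_intP h] := eqVneq (coef_int (chart s t a) p) 0.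
    rewrite c0 if_same mpolyC0 scale0r mul0r.
    by apply/fracE; exists 0%N; rewrite to_quotmod_eq0 ?scaler0 // (rpred0 I).
  transitivity ((coef_int (chart s t a) p)%:MP *: mono s a).
    case: ifP => [va|_]; last by [].
    by rewrite (mono_eq0 va (chart_ge0 h)) !scaler0.
  by rewrite (monoE h) fracZ to_quotmodZ.
rewrite frac_sum to_quotmod_sum; congr (frac _ (pi _) t); apply/mpolyP => m; rewrite raddf_sum /=.
have other a : a != fine_degree s t m ->
    ((coef_int (chart s t a) p)%:MP * 'X_[expo (chart s t a)])@_m = 0.
  move=> am; rewrite mcoeffCM mcoeffX; case: eqP => [em|_]; last by rewrite mulr0.
  apply/eqP; rewrite mulr1; apply: contraNT am => /coef_intP h.
  by apply/eqP/ffunP => i; rewrite ffunE -em mnmE gez0_abs // /chart addrK.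
have [mp|mp] := boolP (m \in msupp p).
  have mA : fine_degree s t m \in A by apply: sA; exact: map_f.
  rewrite (bigD1_seq _ mA uA) /= big1 => [|a /other //].
  rewrite addr0 mcoeffCM mcoeffX (expo_nat (chart_fine_degree s t m)) eqxx mulr1.
  exact: coef_int_nat (chart_fine_degree s t m).
rewrite big1_seq => [|a _]; first by rewrite memN_msupp_eq0.
have [->|/other //] := eqVneq a (fine_degree s t m).
rewrite mcoeffCM (coef_int_nat _ (chart_fine_degree s t m)).
by rewrite memN_msupp_eq0 ?mul0r.
Qed.

End CechCoefficients.
End FineDegrees.

(** * Maps between multigraded pieces of Cech complexes and their cohomology *)

Section FineMaps.
Variables (k : fieldType) (n : nat) (e : rel 'I_n).
Local Notation S := {mpoly k[n]}.
Local Notation x := (fun i : 'I_n => 'X_i : S).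
Local Notation deg := {ffun 'I_n -> int}.
Implicit Types (s : {set 'I_n}) (a b : deg).

(** What makes [x^a |-> x^b] commute with the Cech differential: [x^b] exists, respectively
    vanishes, wherever [x^a] does. *)
Definition transferable l l' a b : Prop :=
  (forall i, 0 <= a i -> 0 <= b i) /\
  (forall s, vanishing e l s a -> vanishing e l' s b).

Definition transfer l (I I' : submodClosed S^o) a b s
    (y : loc (quotmod I) (xprod x s)) : loc (quotmod I') (xprod x s) :=
  (coef e l a y)%:MP *: mono I' s b.

(* Moves the part of multidegree [a] to multidegree [b] and kills all others. *)
Definition fine_map l (I I' : submodClosed S^o) a b
    (c : cech x (quotmod I)) : cech x (quotmod I') :=
  fun s => transfer l I' a b (c s).

Section Fixed.
Variables (l l' : nat) (I I' : submodClosed S^o).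
Hypotheses (hI : cover_power e l I) (hI' : cover_power e l' I').
Variables (a b : deg).
Local Notation C := (cech x (quotmod I)).
Local Notation C' := (cech x (quotmod I')).
Local Notation fmap := (@fine_map l I I' a b).

Local Notation trans := (transfer l I' a b).

Lemma transferD s (y z : loc (quotmod I) (xprod x s)) :
  trans (y + z) = trans y + trans z.
Proof. by rewrite /transfer (coefD hI) mpolyCD scalerDl. Qed.

Lemma transferZ s r (y : loc (quotmod I) (xprod x s)) :
  trans (r%:MP *: y) = r%:MP *: trans y.
Proof. by rewrite /transfer (coefZ hI) mpolyCM -scalerA. Qed.

Lemma transfer0 s : trans (0 : loc (quotmod I) (xprod x s)) = 0.
Proof. by rewrite /transfer (coef0 hI) mpolyC0 scale0r. Qed.

Lemma fine_mapD (c d : C) : fmap (c + d) = fmap c + fmap d.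
Proof. by apply: functional_extensionality_dep => s; exact: transferD. Qed.

Lemma fine_mapZ r (c : C) : fmap (r%:MP *: c) = r%:MP *: fmap c.
Proof. by apply: functional_extensionality_dep => s; exact: transferZ. Qed.

Lemma fine_mapB (c d : C) : fmap (c - d) = fmap c - fmap d.
Proof.
have N1 : -1 = (-1)%:MP :> S by rewrite mpolyCN mpolyC1.
by rewrite fine_mapD -(scaleN1r d) N1 fine_mapZ -N1 scaleN1r.
Qed.

Hypothesis ab : transferable l l' a b.

Lemma nonneg_off_transfer s : nonneg_off s a -> nonneg_off s b.
Proof.
move=> /forallP h; apply/forallP => i; apply/implyP => si.
by apply: ab.1; have := h i; rewrite si.
Qed.

Lemma transfer_loc_map s i (y : loc (quotmod I) (xprod x (s :\ i))) : i \in s ->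
  loc_map (xprod x s) ('X_i) (trans y) = trans (loc_map (xprod x s) ('X_i) y).
Proof.
move=> si.
have linZ r (z : loc (quotmod I') (xprod x (s :\ i))) :
    loc_map (xprod x s) ('X_i) (r *: z) =
    r *: loc_map (xprod x s) ('X_i) z.
  rewrite -[z]fracK fracZ !(loc_map_frac _ _ (xprodD1 k si)) fracZ !scalerA.
  by rewrite mulrC.
rewrite /transfer linZ (coef_loc_map hI) //.
(* A nonzero coefficient ensures that [x^a], hence [x^b], exists in the localization at [s :\ i], so
   that [mono] is meaningful. *)
have [c0|c0] := eqVneq (coef e l a y) 0.
  by rewrite c0 if_same mpolyC0 !scale0r.
have sa : nonneg_off (s :\ i) a.
  by apply: contraNT c0 => /(coef_eq0 hI y) ->.
rewrite (loc_map_mono _ si (nonneg_off_transfer sa)).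
(* If [x^a] dies in the localization at [x_s], then so does [x^b]. *)
case: ifP => [va|_]; last by [].
have sa' : nonneg_off s a.
  apply/forallP => v; apply/implyP => sv.
  by have /forallP/(_ v) := sa; rewrite inE negb_and sv orbT.
by rewrite (mono_eq0 hI' (ab.2 _ va) (nonneg_off_transfer sa')) !scaler0.
Qed.

Lemma cech_d_fine_map (c : C) : cech_d (fmap c) = fmap (cech_d c).
Proof.
apply: functional_extensionality_dep => s.
rewrite /cech_d [RHS](big_morph _ (@transferD s) (transfer0 s)); apply: eq_bigr => i si.
(* Transfers are linear over [k] only, so the sign must be seen as a constant polynomial. *)
have sgnE N : (-1) ^+ N = ((-1) ^+ N)%:MP :> S.
  by rewrite rmorphXn /= mpolyCN mpolyC1.
by rewrite (transfer_loc_map _ si) sgnE [RHS]transferZ.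
Qed.

Variable j : nat.

Lemma cocycle_valB (M : lmodType S) (u v : cocycle x M j) : val (u - v) = val u - val v.
Proof. exact: (raddfB (val : cocycle x M j -> cech x M)). Qed.

Fact fine_map_cocycle (c : cocycle x (quotmod I) j) :
  fmap c \in @cocycles S n x (quotmod I') j.
Proof.
have /asboolP[c0 dc] := valP c; apply/asboolP; split.
  by move=> s sj; rewrite /fine_map c0 // transfer0.
rewrite cech_d_fine_map dc; apply: functional_extensionality_dep => s.
exact: transfer0.
Qed.
Definition fine_cocycle c : cocycle x (quotmod I') j := Cocycle (fine_map_cocycle c).

Definition Hm_class (J : submodClosed S^o) : cocycle x (quotmod J) j -> Hm (quotmod J) j :=
  to_quotmod (@coboundaries S n x (quotmod J) j).

Lemma Hm_classP (J : submodClosed S^o) (h : Hm (quotmod J) j) : exists c, h = Hm_class c.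
Proof. by exists (repr (h : Quotient.quot _)); rewrite /Hm_class to_quotmod_repr. Qed.

Lemma Hm_classD (J : submodClosed S^o) (c d : cocycle x (quotmod J) j) :
  Hm_class (J := J) (c + d) = Hm_class c + Hm_class d.
Proof. exact: to_quotmodD. Qed.

Lemma Hm_classZ (J : submodClosed S^o) p (c : cocycle x (quotmod J) j) :
  p *: Hm_class (J := J) c = Hm_class (p *: c).
Proof. exact: quotmod_scaleE. Qed.

Lemma Hm_class0 (J : submodClosed S^o) : Hm_class (J := J) 0 = 0.
Proof. by rewrite -(scale0r 0) -(Hm_classZ 0 0) scale0r. Qed.

(** Coboundaries go to coboundaries because [fine_map] commutes with the differential. *)
Lemma fine_cohomology_exists :
  exists F : Hm (quotmod I) j -> Hm (quotmod I') j,
    forall c, F (Hm_class c) = Hm_class (fine_cocycle c).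
Proof.
exists (fun h => Hm_class (fine_cocycle
  (repr (h : Quotient.quot (zmod_pred (@coboundaries S n x _ j)))))) => c.
apply/to_quotmodE; set c' := repr _.
have /to_quotmodE/asboolP[d [d0 dE]] : Hm_class c' = Hm_class c by exact: to_quotmod_repr.
apply/asboolP; exists (fmap d); split.
  by move=> s sj; rewrite /fine_map d0 // transfer0.
rewrite cech_d_fine_map -dE.
rewrite [LHS]cocycle_valB [X in _ = fmap X]cocycle_valB.
by rewrite fine_mapB.
Qed.

Variable F : Hm (quotmod I) j -> Hm (quotmod I') j.
Hypothesis FE : forall c, F (Hm_class c) = Hm_class (fine_cocycle c).

Lemma fine_cohomologyD (h h' : Hm (quotmod I) j) : F (h + h') = F h + F h'.
Proof.
have [c ->] := Hm_classP h; have [d ->] := Hm_classP h'.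
transitivity (F (Hm_class (c + d))); first by congr F; exact: esym (Hm_classD c d).
rewrite !FE -(Hm_classD (fine_cocycle c)); congr Hm_class.
by apply: val_inj; exact: fine_mapD.
Qed.

Lemma fine_cohomologyZ r (h : Hm (quotmod I) j) : F (r%:MP *: h) = r%:MP *: F h.
Proof.
have [c ->] := Hm_classP h.
transitivity (F (Hm_class (r%:MP *: c))); first by congr F; exact: Hm_classZ.
rewrite !FE (Hm_classZ _ (fine_cocycle c)).
by congr Hm_class; apply: val_inj; exact: fine_mapZ.
Qed.

(** A cochain of degree [d] has coefficients only in multidegrees of total [d]. Hence a form
    composed with [F] is supported in a single degree and is again a graded form. *)
Lemma fine_cohomology_piece d (h : Hm (quotmod I) j) :
  Hm_piece (cyclic_grading I) d h -> d != \sum_i a i -> F h = 0.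
Proof.
move=> [c [-> cd]] da; rewrite -/(Hm_class c) FE.
rewrite (_ : fine_cocycle c = 0) ?Hm_class0 //.
apply: val_inj; apply: functional_extensionality_dep => s.
have [m [t [E [p mE pd]]]] := cd s.
suff c0 : coef e l a (val c s) = 0.
  by transitivity (trans (val c s)); [reflexivity|rewrite /transfer c0 mpolyC0 scale0r].
rewrite E mE (coef_frac hI); case: ifP => [//|_].
apply: contraNeq da => nz; have h0 := coef_intP nz.
move: nz; rewrite /coef_int (introT forallP h0) -mcoeff_msupp => nz.
have PosD (f : 'I_n -> nat) : (\sum_i f i)%N%:Z = \sum_i (f i)%:Z.
  by rewrite -natz natr_sum; apply: eq_bigr => i _; rewrite natz.
have degE : (mdeg (expo (chart s t a)))%:Z = \sum_i a i + (t * #|s|)%N%:Z.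
  have -> : (t * #|s| = \sum_i t * (i \in s))%N.
    rewrite -sum1_card big_distrr big_mkcond; apply: eq_bigr => i _ /=.
    by case: (i \in s); rewrite ?muln0.
  rewrite mdegE !PosD -big_split; apply: eq_bigr => i _.
  by rewrite mnmE gez0_abs ?h0.
apply/eqP/(addIr (t * #|s|)%N%:Z); rewrite -degE.
case: (d + _)%R pd => [N|N] pd; last by rewrite pd msupp0 in nz.
by rewrite (dhomog_mf pd nz).
Qed.

End Fixed.
End FineMaps.

(** * Comparison of multidegrees for consecutive symbolic powers *)

Section Comparison.
Variables (k : fieldType) (n : nat) (e : rel 'I_n).
Local Notation S := {mpoly k[n]}.
Local Notation x := (fun i : 'I_n => 'X_i : S).
Local Notation deg := {ffun 'I_n -> int}.
Implicit Types (s : {set 'I_n}) (a b : deg) (u : 'X_{1..n}).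

(** The only term of [g] leading from degree [a'] to degree [b'] is the one in [x^u], so the detour
    through [I'] amounts to the direct map from [a] to [b] times a scalar. *)
Lemma fine_map_comp l l' (I I' : submodClosed S^o) a a' b b' u g
    (c : cech x (quotmod I)) :
  cover_power e l I -> cover_power e l' I' ->
  transferable e l l' a a' -> transferable e l' l b' b -> transferable e l l a b ->
  (forall i, b' i = a' i + (u i)%:Z) ->
  fine_map e l' I b' b (g *: fine_map e l I' a a' c) =
  (g@_u)%:MP *: fine_map e l I a b c.
Proof.
move=> hI hI' aa' bb' ab bE; apply: functional_extensionality_dep => s.
rewrite cechZ /fine_map cechZ /transfer.
have [c0|nz] := eqVneq (coef e l a (c s)) 0.
  by rewrite c0 mpolyC0 !scale0r !scaler0 (coef0 hI') mpolyC0 scale0r.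
have sa : nonneg_off s a by apply: contraNT nz => /(coef_eq0 hI (c s)) ->.
have swap (y : loc (quotmod I') (xprod x s)) r : g *: (r%:MP *: y) = r%:MP *: (g *: y).
  by rewrite !scalerA mulrC.
rewrite swap (coefZ hI') (coef_mono hI' _ (nonneg_off_transfer aa' sa) bE).
(* Where [x^b'] vanishes modulo [I'], [x^b] vanishes modulo [I], so both sides are zero. *)
clear swap; case: ifP => [vb|_]; last by rewrite mulrC mpolyCM -scalerA.
by rewrite (mono_eq0 hI (bb'.2 _ vb) (nonneg_off_transfer ab sa)) !scaler0.
Qed.

Lemma mpolyX_fine_map l (I : submodClosed S^o) a b u (c : cech x (quotmod I)) :
  cover_power e l I -> (forall i, b i = a i + (u i)%:Z) ->
  'X_[u] *: fine_map e l I a a c = fine_map e l I a b c.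
Proof.
move=> hI bE; apply: functional_extensionality_dep => s.
rewrite cechZ /fine_map /transfer.
have [c0|nz] := eqVneq (coef e l a (c s)) 0.
  by rewrite c0 mpolyC0 !scale0r scaler0.
have sa : nonneg_off s a by apply: contraNT nz => /(coef_eq0 hI (c s)) ->.
by rewrite -(mulX_mono I sa bE) !scalerA mulrC.
Qed.

Lemma fine_map_decomposition l (I : submodClosed S^o) (c : cech x (quotmod I)) :
  cover_power e l I ->
  exists A : seq deg, c = \sum_(a <- A) fine_map e l I a a c.
Proof.
move=> hI.
have [A hA] : exists A : seq deg, forall s, exists p t,
    c s = frac (xprod x s) (to_quotmod I p) t /\
    {subset [seq fine_degree s t m | m <- msupp p] <= A}.
  (* One fraction is fixed for each of the finitely many [s], and all their degrees are collected in
     one list. *)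
  pose P s y := c s = frac (xprod x s) (to_quotmod I y.1) y.2.
  have /choice[f fP] : forall s, exists y : S * nat, P s y.
    by move=> s; have [p [t E]] := loc_reprP (c s); exists (p, t).
  exists (flatten [seq [seq fine_degree s (f s).2 m | m <- msupp (f s).1]
                  | s <- enum {set 'I_n}]) => s.
  exists (f s).1, (f s).2; split=> [|b bs]; first exact: fP.
  by apply/flatten_mapP; exists s; rewrite ?mem_enum.
exists (undup A); apply: functional_extensionality_dep => s.
have -> : (\sum_(a <- undup A) fine_map e l I a a c) s =
    \sum_(a <- undup A) fine_map e l I a a c s.
  by elim: (undup A) => [|a r IH]; rewrite ?big_nil // !big_cons cechD IH.
have [p [t [E sA]]] := hA s; rewrite /fine_map /transfer E.
apply/esym/(fine_decomposition hI); first exact: undup_uniq.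
by move=> a /sA; rewrite mem_undup.
Qed.

Lemma transferable_mono l a b : (forall i, a i <= b i) -> transferable e l l a b.
Proof.
move=> ab; split=> [i a0|s /vanishingP h]; first exact: le_trans (ab i).
by apply/vanishingP => i j eij si sj; apply: le_trans (lerD (ab i) (ab j)); exact: h.
Qed.

(* [a_i + a_j >= l] if and only if
   [raise l a_i + raise l a_j >= l + 1]: two entries [>= l / 2] add up to at
   least [l], and two entries [< l / 2] to less than [l]. *)
Definition raise l (a : deg) : deg := [ffun i => a i + ((l%:Z <= a i + a i)%R : nat)%:Z].

Lemma raise_transferable l a : transferable e l l.+1 a (raise l a).
Proof.
split=> [i|s /vanishingP h]; first by rewrite ffunE; lia.
apply/vanishingP => i j eij si sj; have := h i j eij si sj; rewrite !ffunE.
by case: (lerP l%:Z (a i + a i)); case: (lerP l%:Z (a j + a j)); lia.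
Qed.

Lemma transferable_raise l a : transferable e l.+1 l (raise l a) a.
Proof.
(* Signs are reflected because an entry [-1] is never raised, [l] being nonnegative. *)
split=> [i|s /vanishingP h]; first by rewrite ffunE; case: lerP; lia.
apply/vanishingP => i j eij si sj; have := h i j eij si sj; rewrite !ffunE.
by case: (lerP l%:Z (a i + a i)); case: (lerP l%:Z (a j + a j)); lia.
Qed.

(** A larger entry is raised whenever a smaller one is, so gaps never shrink; [w] is the excess, [0]
    or [1] in each entry. *)
Lemma raise_gap l a b u : (forall i, b i = a i + (u i)%:Z) ->
  exists w : 'X_{1..n}, forall i, raise l b i = raise l a i + ((u + w)%MM i)%:Z.
Proof.
move=> bE; exists [multinom `|(raise l b i - raise l a i - (u i)%:Z)%R|%N | i < n] => i.
rewrite mnmDE mnmE !ffunE bE.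
by case: lerP; case: lerP; lia.
Qed.

End Comparison.

(** * Annihilators of the dual modules *)

Section Annihilators.
Variables (k : fieldType) (n : nat) (e : rel 'I_n) (l : nat).
Local Notation S := {mpoly k[n]}.
Local Notation x := (fun i : 'I_n => 'X_i : S).
Local Notation deg := {ffun 'I_n -> int}.
Variables (I I' : submodClosed S^o).
Hypotheses (hI : cover_power e l I) (hI' : cover_power e l.+1 I').
Variable j : nat.
Implicit Types (a b : deg) (u : 'X_{1..n}).

Lemma form_fine_cocycle (f : S) (psi : K_module (cyclic_grading I) j) a b u
    (ab : transferable e l l a b) (c : cocycle x (quotmod I) j) :
  annihilates (K_module (cyclic_grading I') j) f ->
  (forall i, b i = a i + (u i)%:Z) ->
  psi (Hm_class ((f@_u)%:MP *: fine_cocycle hI hI ab c)) = 0.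
Proof.
move=> ann bE.
have [w wE] := raise_gap l bE.
have up := raise_transferable e l a; have down := transferable_raise e l b.
have [F FE] := fine_cohomology_exists hI' hI down j.
(* The form [psi], pulled back along the map from degree [raise l b] to degree [b], belongs to the
   dual for [I'] and is killed by [f]. *)
have psiF : `[< is_graded_form (Hm_grading (cyclic_grading I') j) (fun h => psi (F h)) >].
  have [psiD psiZ _] := gdualP psi; apply/asboolP; split=> [h h'|r h|].
  - by rewrite (fine_cohomologyD FE) psiD.
  - by rewrite (fine_cohomologyZ FE) psiZ.
  exists [:: \sum_i raise l b i] => d h dh; rewrite inE => dl.
  rewrite (fine_cohomology_piece FE dh dl).
  by have := psiZ 0 0; rewrite scaler0 mul0r.
(* The pulled-back form is evaluated on [x^w] times the raised cocycle: the coefficient of [f *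
   'X_[w]] at [u + w] is that of [f] at [u]. *)
pose c' := fine_cocycle hI hI' up c.
have : gdual_val (f *: (GDual psiF : K_module (cyclic_grading I') j)) (Hm_class ('X_[w] *: c')) = 0.
  by rewrite ann.
rewrite /= => <-; congr (gdual_val psi _).
transitivity (F (Hm_class (f *: ('X_[w] *: c')))); last by congr F; exact: esym (Hm_classZ _ _).
rewrite FE; congr Hm_class; apply: val_inj.
transitivity (fine_map e l.+1 I (raise l b) b ((f * 'X_[w]) *: fine_map e l I' a (raise l a) c)).
  by rewrite (fine_map_comp _ _ hI hI' up down ab wE) addmC mcoeffMX.
by rewrite -scalerA.
Qed.

Lemma annihilates_cover_power (f : S) :
  annihilates (K_module (cyclic_grading I') j) f ->
  annihilates (K_module (cyclic_grading I) j) f.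
Proof.
move=> ann psi; apply: gdual_eq => h.
transitivity (psi (f *: h)); first by [].
have [psiD psiZ _] := gdualP psi.
have psi0 : psi 0 = 0 by have := psiZ 0 0; rewrite scaler0 mul0r.
have [c ->] := Hm_classP h.
have [A cE] := fine_map_decomposition c hI.
pose add a u : deg := [ffun i => a i + (u i)%:Z].
have addE a u i : add a u i = a i + (u i)%:Z by rewrite ffunE.
have mono a u : transferable e l l a (add a u).
  by apply: transferable_mono => i; rewrite addE lerDl.
pose term a u := (f@_u)%:MP *: fine_cocycle hI hI (mono a u) c.
(* The product is split by the multidegrees [a] of [c] and the monomials [u] of [f]; each term is
   killed by [psi] separately. *)
have fcE : f *: c = \sum_(a <- A) \sum_(u <- msupp f) term a u.
  apply: val_inj; rewrite [LHS]linearZ /= {1}cE scaler_sumr.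
  rewrite [RHS](raddf_sum (val : cocycle x (quotmod I) j -> cech x (quotmod I))).
  apply: eq_bigr => a _.
  rewrite [RHS](raddf_sum (val : cocycle x (quotmod I) j -> cech x (quotmod I))).
  rewrite {1}[f]mpolyE scaler_suml; apply: eq_bigr => u _.
  by rewrite -mul_mpolyC -scalerA (mpolyX_fine_map _ hI (addE a u)).
transitivity (psi (Hm_class (f *: c))); first by congr (gdual_val psi _); exact: Hm_classZ.
pose form d := psi (Hm_class d).
have formD d d' : form (d + d') = form d + form d'.
  by rewrite /form (Hm_classD d d') psiD.
have form0 : form 0 = 0 by rewrite /form Hm_class0 psi0.
rewrite -/(form _) fcE (big_morph form formD form0) big1 // => a _.
rewrite (big_morph form formD form0) big1 // => u _.
exact: form_fine_cocycle ann (addE a u).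
Qed.
End Annihilators.

(** * From annihilators to dimensions and depth *)

(** A chain of primes over [Ann M] is also one over the smaller ideal [Ann N]. *)
Lemma krull_dim_ge_subset (R : comNzRingType) (M N : lmodType R) t :
  (forall a, annihilates N a -> annihilates M a) ->
  krull_dim_ge M t -> krull_dim_ge N t.
Proof.
move=> NM [s [P [ts annP chain]]]; exists s, P; split=> // a /NM; exact: annP.
Qed.

Lemma le_oo_min_nat (A B : nat -> Prop) :
  (forall j, B j -> A j) -> le_oo (min_nat A) (min_nat B).
Proof.
move=> BA; rewrite /min_nat.
case: pselect => [exA|nA]; case: pselect => [exB|nB] //=.
  case: ex_minnP => m _ min_m; case: ex_minnP => m' /asboolP/BA Am' _.
  by apply: min_m; apply/asboolP.
by case: nA; have [m /asboolP/BA Am] := exB; exists m; apply/asboolP.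
Qed.

Local Close Scope quotient_scope.
Local Close Scope ring_scope.

Theorem proposition5p6 (k : fieldType) (n : nat) (e : rel 'I_n)
    (e_sym : symmetric e) (e_irr : irreflexive e) (l : nat) (hl : 1 <= l) :
  le_oo (cyclic_S_depth 2 (symbolic_pow (cover_ideal k e) l.+1))
        (cyclic_S_depth 2 (symbolic_pow (cover_ideal k e) l)).
Proof.
apply: le_oo_min_nat => j; apply: krull_dim_ge_subset => f.
by apply: (@annihilates_cover_power k n e l) => p; exact: symbolic_pow_cover_idealP.
Qed.
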